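(* Let $p$ and $r$ be non-negative integers with $p \geq r+2$. For a positive integer $n$, let $a_{r}(n,p)$ denote the total number of parts congruent to $-r \pmod{p}$, counted over all partitions of $n$ into distinct parts. Let $g_{r,o}(n,p)$ (resp. $g_{r,e}(n,p)$) denote the number of partitions of $n$ in which exactly one part is repeated (all other parts appear exactly once), the multiplicity of this repeated part is at least $p-r$ and congruent to $-r$ or $-r+1 \pmod{p}$, and the repeated part is odd (resp. even). Then for all $n \geq 1$, $$a_{r}(n,p) = g_{r,o}(n,p) - g_{r,e}(n,p).$$
   Context: A partition of $n$ is a non-increasing sequence of positive integers (parts) summing to $n$; the multiplicity of a part is the number of times it appears. *)

(* Defs.v *)
From HB Require Import structures.
From mathcomp Require Import all_boot all_order all_algebra.

Set Implicit Arguments.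
Unset Strict Implicit.
Unset Printing Implicit Defensive.

Definition is_partition (n : nat) (s : seq nat) : bool :=
  [&& sorted geq s, all (ltn 0) s & sumn s == n].

Record intpartn (n : nat) : Type := IntPartn {
  parts :> seq nat;
  partsP : is_partition n parts
}.

HB.instance Definition _ n := [isSub for @parts n].
HB.instance Definition _ n := [Countable of intpartn n by <:].

Section Finiteness.

Variable n : nat.

(* A partition of n has at most n parts, each of them at most n. *)
Definition bseq_of_partn (la : intpartn n) : n.-bseq 'I_n.+1 :=
  insub_bseq n [seq inord x | x <- la].

Definition partn_of_bseq (b : n.-bseq 'I_n.+1) : option (intpartn n) :=
  insub [seq val i | i <- b].

Lemma size_le_sumn (s : seq nat) : all (ltn 0) s -> size s <= sumn s.
Proof.
by elim: s => //= x s IHs /andP[x_gt0 /IHs le_s]; rewrite -add1n leq_add.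
Qed.

Lemma mem_le_sumn (s : seq nat) x : x \in s -> x <= sumn s.
Proof.
elim: s => //= y s IHs; rewrite inE => /orP[/eqP-> | /IHs le_x].
  exact: leq_addr.
exact: leq_trans le_x (leq_addl _ _).
Qed.

Lemma bseq_of_partnK : pcancel bseq_of_partn partn_of_bseq.
Proof.
case=> s s_part; have /and3P[_ s_gt0 /eqP s_sum] := s_part.
rewrite /partn_of_bseq /bseq_of_partn /=.
have le_sz : size [seq inord x : 'I_n.+1 | x <- s] <= n.
  by rewrite size_map -[leqRHS]s_sum size_le_sumn.
have -> : [seq val i | i <- insub_bseq n [seq inord x : 'I_n.+1 | x <- s]] = s.
  rewrite /insub_bseq val_insubd le_sz -map_comp.
  apply: map_id_in => x /mem_le_sumn; rewrite s_sum => le_x.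
  by rewrite /= inordK.
by rewrite insubT.
Qed.

End Finiteness.

HB.instance Definition _ n : isFinite (intpartn n) :=
  PCanIsFinite (@bseq_of_partnK n).

Definition mult (x : nat) (s : seq nat) : nat := count_mem x s.

Definition repeated_parts (s : seq nat) : seq nat :=
  [seq x <- undup s | 1 < mult x s].

Definition num_parts_cong (r n p : nat) : nat :=
  \sum_(la : intpartn n | uniq la)
    count (fun x : nat => (x%:Z == - r%:Z %[mod p%:Z])%Z) la.

(* The matched singleton says that x is the only repeated part. *)
Definition one_repeated_part (r p : nat) (P : pred nat) (s : seq nat) : bool :=
  if repeated_parts s is [:: x] then
    let m := mult x s in
    [&& p - r <= m,
        (m%:Z == - r%:Z %[mod p%:Z])%Z || (m%:Z == - r%:Z + 1 %[mod p%:Z])%Z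
      & P x]
  else false.

Definition g_odd (r n p : nat) : nat :=
  #|[set la : intpartn n | one_repeated_part r p odd la]|.

Definition g_even (r n p : nat) : nat :=
  #|[set la : intpartn n | one_repeated_part r p (predC odd) la]|.

(* Main.v *)
(** For x >= 1 let E x m be the number of partitions of n in which x has
    multiplicity m and every other part appears at most once.  Removing the m
    copies of x shows that E x m + E x (m+1) = T (m x), where T k is the number
    of partitions of n - k into distinct parts (0 if k > n).  Write M for the
    set of m >= 1 with m = -r (mod p).  Telescoping in m gives
    E x 1 = sum_(j >= 1) (-1)^(j+1) T (j x), so the left-hand side of the theorem
    is the sum over x in M of these.  As p >= r + 2, the multiplicities allowed
    for the repeated part are exactly m and m + 1 for m in M, so the right-hand
    side is the sum over x >= 1 and m in M of
    (-1)^(x+1) (E x m + E x (m+1)) = (-1)^(x+1) T (m x), the same double sum. *)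

Require Import Defs.
From mathcomp Require Import all_boot all_order all_algebra.
From mathcomp Require Import zify ring.

Import GRing.Theory.

(** * Removing and restoring the copies of one part *)

Definition others (x : nat) (s : seq nat) : seq nat := [seq y <- s | y != x].

Definition distinct_count (n : nat) : nat := #|[set la : intpartn n | uniq la]|.

(** This is [E x m], with [n] made explicit so that it can vary. *)
Definition almost_distinct_count (x m n : nat) : nat :=
  #|[set la : intpartn n | (mult x la == m) && uniq (others x la)]|.

Lemma perm_others (x : nat) (s : seq nat) :
  perm_eq (nseq (mult x s) x ++ others x s) s.
Proof.
rewrite perm_sym -(perm_filterC (pred1 x)) perm_cat2r.
have := filter_all (pred1 x) s => /all_pred1P {1}->.
by rewrite size_filter.
Qed.

Lemma sumn_others (x : nat) (s : seq nat) :
  sumn s = mult x s * x + sumn (others x s).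
Proof. by rewrite -(perm_sumn (perm_others x s)) sumn_cat sumn_nseq mulnC. Qed.

Lemma others_idem {x} (m : nat) {s : seq nat} :
  mult x s = 0 -> others x (nseq m x ++ s) = s.
Proof.
move=> /eqP; rewrite /others filter_cat filter_nseq eqxx /= -leqn0 leqNgt -has_count.
rewrite has_pred1 => x_s; apply/all_filterP/allP => y ys.
by apply: contraNneq x_s => <-.
Qed.

Lemma mult_others (x : nat) (s : seq nat) : mult x (others x s) = 0.
Proof.
by apply/eqP; rewrite -leqn0 leqNgt -has_count has_pred1 mem_filter eqxx.
Qed.

Lemma geq_total : total geq.
Proof. by move=> x y; exact: leq_total. Qed.

Lemma geq_trans : transitive geq.
Proof. by move=> y x z /= xy yz; exact: leq_trans xy. Qed.

Lemma geq_anti : antisymmetric geq.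
Proof. by move=> x y; rewrite /= andbC; exact: anti_leq. Qed.

Lemma sort_geq_id (s : seq nat) : sorted geq s -> sort geq s = s.
Proof. exact: (sorted_sort geq_trans). Qed.

Lemma is_partition_add_copies {x} (m : nat) {n} {s : seq nat} : 0 < x ->
  is_partition n s -> is_partition (n + m * x) (sort geq (nseq m x ++ s)).
Proof.
move=> x0 /and3P[_ s0 /eqP <-]; apply/and3P; split.
- exact: (sort_sorted geq_total).
- by rewrite all_sort all_cat s0 all_nseq /= x0 orbT.
- by rewrite (perm_sumn (permEl (perm_sort _ _))) sumn_cat sumn_nseq mulnC addnC.
Qed.

Definition add_copies {x} (m : nat) {n} (x0 : 0 < x) (la : intpartn n) :
    intpartn (n + m * x) :=
  IntPartn (is_partition_add_copies m x0 (partsP la)).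

Lemma is_partition_others (x n : nat) (s : seq nat) :
  is_partition (n + mult x s * x) s -> is_partition n (others x s).
Proof.
move=> /and3P[s_sorted s0 /eqP s_sum]; apply/and3P; split.
- exact: (sorted_filter geq_trans).
- by rewrite all_filter; apply: sub_all s0 => y y0; exact/implyP.
- by move: s_sum; rewrite (sumn_others x); lia.
Qed.

Lemma others_add_copies {x} (m : nat) {n} (x0 : 0 < x) {la : intpartn n} :
  mult x la = 0 -> others x (add_copies m x0 la) = la.
Proof.
move=> la0; rewrite /others /= (filter_sort geq_total geq_trans).
rewrite -/(others x _) others_idem //; apply: sort_geq_id.
by case/and3P: (partsP la).
Qed.

(** Inserting [m] copies of [x] and sorting again is a bijection from the partitions without [x];
    its inverse is [others x]. *)
Lemma almost_distinct_count_shift (x m n : nat) : 0 < x ->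
  almost_distinct_count x m (n + m * x) = almost_distinct_count x 0 n.
Proof.
move=> x0; rewrite /almost_distinct_count.
set A := [set _ | _]; set B := [set _ | _].
have f_inj : {in B &, injective (@add_copies x m n x0)}.
  move=> la mu; rewrite !inE => /andP[/eqP la0 _] /andP[/eqP mu0 _] eq_f.
  by apply: val_inj; rewrite /= -(others_add_copies m x0 la0) eq_f others_add_copies.
rewrite -(card_in_imset f_inj); congr #|pred_of_set _|; apply/setP=> la.
apply/idP/imsetP => [|[mu]]; rewrite !inE => /andP[/eqP mult_x uniq_x].
- have /is_partition_others mu_part : is_partition (n + mult x la * x) la.
    by rewrite mult_x partsP.
  exists (IntPartn mu_part); first rewrite inE /= mult_others eqxx /=.
    by rewrite filter_uniq.
  apply: val_inj => /=; have perm_x := perm_others x la; rewrite mult_x in perm_x.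
  have /and3P[la_sorted _ _] := partsP la.
  apply: (sorted_eq geq_trans geq_anti) => //; first exact: (sort_sorted geq_total).
  by rewrite perm_sym perm_sort.
- move=> ->; rewrite (others_add_copies m x0 mult_x).
  rewrite /mult /= (seq.permP (permEl (perm_sort _ _))) count_cat count_nseq /=.
  rewrite eqxx mul1n -/(mult x mu) mult_x addn0 eqxx /=.
  (* With zero copies, [others_idem] says that [others x mu] is [mu] itself. *)
  by rewrite -(others_idem 0 mult_x).
Qed.

(** * The recurrence in the multiplicity and its telescoping *)

Lemma almost_distinct_count_gt (x m n : nat) :
  n < m * x -> almost_distinct_count x m n = 0.
Proof.
move=> lt_n; apply/eqP; rewrite cards_eq0; apply/eqP/setP=> la; rewrite !inE.
apply: contraTF lt_n => /andP[/eqP <- _]; have /and3P[_ _ /eqP la_sum] := partsP la.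
by have := sumn_others x la; rewrite la_sum; lia.
Qed.

Lemma uniq_others (x : nat) (s : seq nat) :
  uniq s = (mult x s <= 1) && uniq (others x s).
Proof.
rewrite -(perm_uniq (perm_others x s)) cat_uniq.
have -> : has (mem (nseq (mult x s) x)) (others x s) = false.
  by apply/hasPn=> y; rewrite mem_filter /= mem_nseq => /andP[/negPf-> _]; rewrite andbF.
by case: (mult x s) => [|[|m]] //=; rewrite inE eqxx.
Qed.

Lemma distinct_countE (x n : nat) :
  distinct_count n = almost_distinct_count x 0 n + almost_distinct_count x 1 n.
Proof.
rewrite /distinct_count /almost_distinct_count -!sum1dep_card.
rewrite big_mkcond [X in _ = X + _]big_mkcond [X in _ = _ + X]big_mkcond -big_split.
apply: eq_bigr => la _ /=.
by rewrite (uniq_others x); case: (mult x la) => [|[|m]] //=; case: uniq.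
Qed.

(** This is [T k]. The test matters: for [k > n] the truncated [n - k] is 0, and the empty partition
    would be counted. *)
Definition distinct_count_sub (n k : nat) : nat :=
  if k <= n then distinct_count (n - k) else 0.

Lemma almost_distinct_count_succ (x m n : nat) : 0 < x ->
  almost_distinct_count x m n + almost_distinct_count x m.+1 n
    = distinct_count_sub n (m * x).
Proof.
move=> x0; rewrite /distinct_count_sub; case: leqP => [le_n | lt_n]; last first.
  by rewrite !almost_distinct_count_gt // mulSn; lia.
rewrite (distinct_countE x); move: (n - m * x) (subnK le_n) => k <-.
(* The remaining terms both equal [almost_distinct_count x 0 (k - x)] when [x <= k], and both vanish
   otherwise. *)
rewrite almost_distinct_count_shift //; congr (_ + _); case: (leqP x k) => [le_x | lt_x].
  move: (k - x) (subnK le_x) => l <-; rewrite -addnA -mulSn almost_distinct_count_shift //.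
  by rewrite -[X in l + X]mul1n almost_distinct_count_shift.
by rewrite !almost_distinct_count_gt // ?mul1n // mulSn; lia.
Qed.

Lemma almost_distinct_count1E (x n : nat) : 0 < x ->
  ((almost_distinct_count x 1 n)%:Z =
    \sum_(1 <= j < n.+1) (-1) ^+ j.+1 * (distinct_count_sub n (j * x))%:Z)%R.
Proof.
move=> x0.
(* Finite telescoping with a remainder; at [k = n] the remainder vanishes because [n.+1 * x > n]. *)
have telescope k : ((almost_distinct_count x 1 n)%:Z =
    \sum_(1 <= j < k.+1) (-1) ^+ j.+1 * (distinct_count_sub n (j * x))%:Z
      + (-1) ^+ k * (almost_distinct_count x k.+1 n)%:Z)%R.
  elim: k => [|k IHk]; first by rewrite big_geq // add0r mul1r.
  rewrite big_nat_recr //= -(almost_distinct_count_succ x k.+1) // PoszD IHk !exprS.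
  ring.
rewrite (telescope n) almost_distinct_count_gt ?mulr0 ?addr0 //.
exact: leq_pmulr.
Qed.

(** * Congruences and the left-hand side *)

Lemma sum_indicator_eq (P : pred nat) (y : nat) (s : seq nat) :
  \sum_(x <- s | P x) (x == y) = P y * count_mem y s.
Proof.
elim: s => [|x s IHs]; first by rewrite big_nil muln0.
rewrite big_cons IHs /=; case: eqVneq => [->|_]; last by case: ifP.
by case: (P y); rewrite ?mul0n ?mul1n.
Qed.

Lemma eqz_modN_dvd (p r x : nat) :
  (x%:Z == - r%:Z %[mod p%:Z])%Z = (p %| x + r).
Proof. by rewrite eqz_mod_dvd opprK -PoszD. Qed.

Lemma eqz_modN1_dvd (p r x : nat) : 0 < x ->
  (x%:Z == - r%:Z + 1 %[mod p%:Z])%Z = (p %| x.-1 + r).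
Proof.
case: x => // x _; rewrite eqz_mod_dvd -eqz_modN_dvd eqz_mod_dvd.
by have -> : (x.+1%:Z - (- r%:Z + 1) = x%:Z - - r%:Z)%R by lia.
Qed.

Lemma mem_intpartn (n : nat) (la : intpartn n) (x : nat) :
  x \in parts la -> x \in index_iota 1 n.+1.
Proof.
case/and3P: (partsP la) => _ /allP la0 /eqP la_sum x_la.
rewrite mem_index_iota ltnS; apply/andP; split; first exact: la0.
by rewrite -[X in _ <= X]la_sum mem_le_sumn.
Qed.

(** Exchange of sums: a part of a partition into distinct parts occurs once, and multiplicity 1 with
    distinct other parts means that all parts are distinct. *)
Lemma num_parts_congE (r n p : nat) :
  num_parts_cong r n p
    = \sum_(1 <= m < n.+1 | p %| m + r) almost_distinct_count m 1 n.
Proof.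
rewrite /num_parts_cong /almost_distinct_count.
under [RHS]eq_bigr do rewrite -sum1dep_card big_mkcond.
rewrite exchange_big big_mkcond; apply: eq_bigr => la _ /=.
case: ifP => la_uniq.
  have perm_la : perm_eq la [seq x <- index_iota 1 n.+1 | x \in parts la].
    apply: uniq_perm; rewrite ?filter_uniq ?iota_uniq // => x; rewrite mem_filter.
    by case: (boolP (x \in parts la)) => //= /mem_intpartn.
  rewrite -sum1_count (perm_big _ perm_la) big_filter_cond -big_mkcondr.
  apply: eq_bigl => x; rewrite eqz_modN_dvd andbC; congr (_ && _).
  have := la_uniq; rewrite (uniq_others x) => /andP[_ ->].
  by rewrite andbT /mult count_uniq_mem //; case: (_ \in _).
rewrite big1 // => x _; case: ifP => // /andP[/eqP mult_x uniq_x].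
by rewrite (uniq_others x) mult_x uniq_x in la_uniq.
Qed.

(** * Partitions with exactly one repeated part *)

Lemma mult_others_neq (x y : nat) (s : seq nat) :
  y != x -> mult y (others x s) = mult y s.
Proof.
move=> y_x; rewrite /mult count_filter; apply: eq_count => z /=.
by case: eqVneq => // ->.
Qed.

Lemma uniq_others_repeated (x : nat) (s : seq nat) : 1 < mult x s ->
  uniq (others x s) = (repeated_parts s == [:: x]).
Proof.
move=> x_rep; have mem_rep y : (y \in repeated_parts s) = (1 < mult y s).
  rewrite mem_filter mem_undup -has_pred1 has_count -/(mult y s).
  by case: (mult y s) => [|[]].
apply/idP/eqP => [uniq_x | rep_s].
  apply: perm_small_eq => //; apply: uniq_perm => // [|y].
    by rewrite filter_uniq ?undup_uniq.
  rewrite mem_rep inE; case: eqVneq => [->|y_x] //.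
  by rewrite -(mult_others_neq _ _ s y_x) /mult count_uniq_mem //; case: (_ \in _).
apply: count_mem_uniq => y; have [->|y_x] := eqVneq y x.
  by rewrite mem_filter eqxx; exact: mult_others.
have := mem_rep y; rewrite rep_s inE (negPf y_x) -(mult_others_neq _ _ s y_x).
rewrite -has_pred1 has_count -/(mult y _).
by case: (mult y _) => [|[]].
Qed.

(** The truncation in [m.-1] is harmless for [r < p], since [p - r <= m] then excludes [m = 0]. *)
Definition good_mult (p r m : nat) : bool :=
  (p - r <= m) && ((p %| m + r) || (p %| m.-1 + r)).

Lemma one_repeated_partE (p r : nat) (Q : pred nat) (s : seq nat) : r < p ->
  one_repeated_part r p Q s =
    if repeated_parts s is [:: x] then good_mult p r (mult x s) && Q x else false.
Proof.
move=> lt_rp; rewrite /one_repeated_part /good_mult.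
case: repeated_parts => [|x [|]] //; rewrite -andbA; case: leqP => //= le_m.
by rewrite eqz_modN_dvd eqz_modN1_dvd //; apply: leq_trans le_m; rewrite subn_gt0.
Qed.

(** As [p >= 2] cannot divide two consecutive numbers, [k] is [m] or [m.+1] for at most one [m] in
    the sum. The bound [p - r <= k] expresses that [m] is positive. *)
Lemma sum_mult_indicator (p r k n : nat) : r + 2 <= p -> k <= n ->
  \sum_(1 <= m < n.+1 | p %| m + r) ((k == m) + (k == m.+1)) = good_mult p r k.
Proof.
move=> hpr le_kn; rewrite big_split /=.
under eq_bigr do rewrite eq_sym.
rewrite sum_indicator_eq count_uniq_mem ?iota_uniq // mem_index_iota /good_mult.
case: k le_kn => [|k] le_kn.
  by rewrite big1 ?muln0 //; have -> : p - r <= 0 = false by lia.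
under eq_bigr do rewrite eqSS eq_sym.
rewrite sum_indicator_eq count_uniq_mem ?iota_uniq // mem_index_iota.
have -> : 0 < k.+1 < n.+1 by lia.
have -> : 0 < k < n.+1 = (0 < k) by lia.
rewrite muln1 /=; have [dvd1 | ndvd1] := boolP (p %| k.+1 + r).
  have -> : p %| k + r = false.
    apply/negP => dvd0; move: dvd1; rewrite addSn -addn1 dvdn_addr // dvdn1; lia.
  by have := dvdn_leq _ dvd1; lia.
have [dvd0 | ndvd0] := boolP (p %| k + r); last by rewrite andbF.
(* For multiplicity 1 both sides are 0: the sum starts at [m = 1], and [p - r >= 2]. *)
by case: k le_kn dvd0 {ndvd1} => [|k] le_kn; [lia | move/(dvdn_leq _); lia].
Qed.

Lemma count_one_repeated (p r n : nat) (Q : pred nat) : r + 2 <= p ->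
  #|[set la : intpartn n | one_repeated_part r p Q la]|
    = \sum_(1 <= x < n.+1 | Q x) \sum_(1 <= m < n.+1 | p %| m + r)
        distinct_count_sub n (m * x).
Proof.
move=> hpr.
transitivity (\sum_(1 <= x < n.+1 | Q x) \sum_(la : intpartn n)
    (good_mult p r (mult x la) && (repeated_parts la == [:: x]) : nat)); last first.
  rewrite big_seq_cond [RHS]big_seq_cond; apply: eq_bigr => x /andP[].
  rewrite mem_index_iota => /andP[x0 _] _.
  under [RHS]eq_bigr => m _.
    rewrite -almost_distinct_count_succ // /almost_distinct_count -!sum1dep_card.
    rewrite [X in X + _]big_mkcond [X in _ + X]big_mkcond -big_split.
    over.
  rewrite exchange_big; apply: eq_bigr => la _ /=.
  have le_n : mult x la <= n.
    have /and3P[_ la0 /eqP la_sum] := partsP la.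
    rewrite -[X in _ <= X]la_sum; exact: leq_trans (count_size _ _) (size_le_sumn la0).
  (* A good multiplicity is at least [p - r >= 2], so [x] is repeated and [uniq_others_repeated]
     applies. *)
  transitivity (good_mult p r (mult x la) * uniq (others x la)).
    rewrite /good_mult; case: leqP => //= le_m.
    rewrite (uniq_others_repeated x); last by lia.
    by rewrite mulnb.
  rewrite -(sum_mult_indicator _ _ _ _ hpr le_n) big_distrl; apply: eq_bigr => m _ /=.
  by case: uniq; rewrite ?andbT ?andbF ?muln0 ?muln1 //; do 2!case: (_ == _).
rewrite exchange_big -sum1dep_card big_mkcond; apply: eq_bigr => la _ /=.
rewrite one_repeated_partE; last by lia.
case E: (repeated_parts la) => [|y [|z t]]; first by rewrite big1 // => x _; rewrite andbF.
  2: by rewrite big1 // => x _; rewrite eqseq_cons /= !andbF.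
(* The only repeated part [y] is a part, hence lies between 1 and [n], and the sum over [x] meets it
   exactly once. *)
have y_la : y \in parts la.
  by have : y \in repeated_parts la; [rewrite E inE | rewrite mem_filter mem_undup => /andP[]].
under eq_bigr => x _ do rewrite eqseq_cons andbT eq_sym -mulnb.
transitivity (\sum_(1 <= x < n.+1 | Q x && good_mult p r (mult x la)) (x == y)).
  by rewrite sum_indicator_eq count_uniq_mem ?iota_uniq // (mem_intpartn n la) // muln1 andbC.
by rewrite big_mkcondr; apply: eq_bigr => x _; case: good_mult; rewrite ?mul1n ?mul0n.
Qed.

(** * Comparison of the two double sums *)

Theorem theorem2 (p r n : nat) (hpr : r + 2 <= p) (hn : 1 <= n) :
  ((num_parts_cong r n p)%:Z = (g_odd r n p)%:Z - (g_even r n p)%:Z)%R.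
Proof.
rewrite num_parts_congE /g_odd /g_even !count_one_repeated //.
rewrite -!natz !natr_sum.
(* The roles swap here: on the left [m] is the part and [x] the telescoping index, on the right [x]
   is the repeated part and [m] gives its multiplicity. Only the product [m * x] enters. *)
transitivity (\sum_(1 <= m < n.+1 | (p %| m + r)%N) \sum_(1 <= x < n.+1)
    (-1) ^+ x.+1 * (distinct_count_sub n (m * x))%:Z)%R.
  rewrite big_seq_cond [RHS]big_seq_cond; apply: eq_bigr => m /andP[].
  rewrite mem_index_iota => /andP[m0 _] _; rewrite natz almost_distinct_count1E //.
  by apply: eq_bigr => x _; rewrite mulnC.
rewrite exchange_big [X in (_ = X - _)%R]big_mkcond [X in (_ = _ - X)%R]big_mkcond.
rewrite -sumrB; apply: eq_bigr => x _ /=.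
(* The sign depends only on the parity of [x]: odd [x] contributes to [g_odd], even [x] to
   [- g_even]. *)
rewrite -mulr_sumr -signr_odd /= natr_sum.
under [in RHS]eq_bigr do rewrite natz.
by case: (odd x); rewrite /= ?expr0 ?expr1 ?mul1r ?mulN1r ?subr0 ?sub0r ?natr_sum.
Qed.
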